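(* Let $G$ be a finite simple graph. Then (1) $\gamma_{\rm gr}^Z(G)\le \operatorname{mr}(G)$; (2) $\gamma_{\rm gr}(G)\le \operatorname{mr}_{\dot\ell}(G)$; (3) $\gamma_{\rm gr}^t(G)\le \operatorname{mr}_0(G)$.
   Context: Let $G$ have vertex set $\{1,\ldots,n\}$. $\mathcal S(G)$ is the set of real symmetric $n\times n$ matrices whose $(i,j)$-entry for $i\ne j$ is nonzero iff $\{i,j\}\in E(G)$ (diagonal unrestricted); $\mathcal S_{\dot\ell}(G)$ is the subset with all diagonal entries nonzero and $\mathcal S_0(G)$ the subset with all diagonal entries zero. $\operatorname{mr}(G),\operatorname{mr}_{\dot\ell}(G),\operatorname{mr}_0(G)$ are the minimum ranks over $\mathcal S(G),\mathcal S_{\dot\ell}(G),\mathcal S_0(G)$ respectively. With $N(x)$, $N[x]$ the open and closed neighborhoods, a sequence $(v_1,\ldots,v_k)$ of distinct vertices is a $Z$-sequence if $N(v_i)\setminus\bigcup_{j<i}N[v_j]\ne\emptyset$ for all $i$; a dominating sequence if $N[v_i]\setminus\bigcup_{j<i}N[v_j]\ne\emptyset$ for all $i$; a total dominating sequence if $N(v_i)\setminus\bigcup_{j<i}N(v_j)\ne\emptyset$ for all $i$. $\gamma_{\rm gr}^Z(G),\gamma_{\rm gr}(G),\gamma_{\rm gr}^t(G)$ are the maximum lengths of such sequences respectively. *)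

(* Defs.v *)
From mathcomp Require Import all_boot all_order all_algebra.
From mathcomp Require Import boolp reals.

Set Implicit Arguments.
Unset Strict Implicit.
Unset Printing Implicit Defensive.

Import GRing.Theory.

Record sgraph (n : nat) := SGraph {
  adj : rel 'I_n;
  adj_sym : symmetric adj;
  adj_irrefl : irreflexive adj }.

Section Neighborhoods.
Variables (n : nat) (G : sgraph n).

Definition open_nbh (x : 'I_n) : {set 'I_n} := [set y | adj G x y].

Definition closed_nbh (x : 'I_n) : {set 'I_n} := x |: open_nbh x.

End Neighborhoods.

Section Sequences.
Variables (n : nat) (G : sgraph n).

Definition Z_sequence k (v : k.-tuple 'I_n) : bool :=
  uniq v &&
  [forall i : 'I_k,
    open_nbh G (tnth v i)
      :\: \bigcup_(j : 'I_k | j < i) closed_nbh G (tnth v j) != set0].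

Definition dominating_sequence k (v : k.-tuple 'I_n) : bool :=
  uniq v &&
  [forall i : 'I_k,
    closed_nbh G (tnth v i)
      :\: \bigcup_(j : 'I_k | j < i) closed_nbh G (tnth v j) != set0].

Definition total_dominating_sequence k (v : k.-tuple 'I_n) : bool :=
  uniq v &&
  [forall i : 'I_k,
    open_nbh G (tnth v i)
      :\: \bigcup_(j : 'I_k | j < i) open_nbh G (tnth v j) != set0].

(* The vertices of a sequence are distinct, so no sequence is longer than n;
   the empty sequence qualifies, so each maximum is over a nonempty set. *)
Definition gamma_gr_Z : nat :=
  \max_(k < n.+1 | [exists v : k.-tuple 'I_n, Z_sequence v]) k.

Definition gamma_gr : nat :=
  \max_(k < n.+1 | [exists v : k.-tuple 'I_n, dominating_sequence v]) k.

Definition gamma_gr_t : nat :=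
  \max_(k < n.+1 | [exists v : k.-tuple 'I_n, total_dominating_sequence v]) k.

End Sequences.

Local Open Scope ring_scope.

Section MinimumRank.
Variables (R : realType) (n : nat).

Lemma ex_rank (S : 'M[R]_n -> Prop) :
  (exists A, S A) -> exists k, `[< exists2 A, S A & \rank A = k >].
Proof. by move=> [A SA]; exists (\rank A); apply/asboolP; exists A. Qed.

Definition min_rank (S : 'M[R]_n -> Prop) (S_ex : exists A, S A) : nat :=
  ex_minn (ex_rank S_ex).

Variable G : sgraph n.

Definition Smat (A : 'M[R]_n) : Prop :=
  A^T = A /\ forall i j, i != j -> (A i j != 0) = adj G i j.

Definition Smat_l (A : 'M[R]_n) : Prop := Smat A /\ forall i, A i i != 0.

Definition Smat_0 (A : 'M[R]_n) : Prop := Smat A /\ forall i, A i i = 0.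

Lemma Smat_0_ex : exists A, Smat_0 A.
Proof.
exists (\matrix_(i, j) (adj G i j)%:R); split; last first.
  by move=> i; rewrite mxE adj_irrefl.
split=> [|i j _]; first by apply/matrixP=> i j; rewrite !mxE adj_sym.
by rewrite mxE; case: (adj G i j); rewrite ?oner_neq0 ?eqxx.
Qed.

Lemma Smat_ex : exists A, Smat A.
Proof. by have [A [SA _]] := Smat_0_ex; exists A. Qed.

Lemma Smat_l_ex : exists A, Smat_l A.
Proof.
have [A [[symA suppA] diagA]] := Smat_0_ex; exists (A + 1%:M); split.
  split=> [|i j neq_ij]; first by rewrite linearD /= symA trmx1.
  by rewrite !mxE (negPf neq_ij) addr0 suppA.
by move=> i; rewrite !mxE diagA eqxx add0r oner_neq0.
Qed.

Definition mr : nat := min_rank Smat_ex.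
Definition mr_l : nat := min_rank Smat_l_ex.
Definition mr_0 : nat := min_rank Smat_0_ex.

End MinimumRank.

Arguments mr R {n} G.
Arguments mr_l R {n} G.
Arguments mr_0 R {n} G.

(* Main.v *)
Require Import Defs.
From mathcomp Require Import all_boot reals.
From mathcomp Require Import all_algebra boolp.

(** Let y_i be a vertex in the neighborhood of v_i that avoids the neighborhoods
    of all earlier v_j. In the submatrix of A with rows v_1, ..., v_k and columns
    y_1, ..., y_k, the entries (v_j, y_i) with j < i vanish and the diagonal entries
    (v_i, y_i) do not, so this submatrix is invertible and A has rank at least k.
    The three cases differ only in which entries are known to be zero or nonzero. *)

Import GRing.Theory.

(** Selecting rows, even with repetition, stays inside the row space; columns reduce to rows by
    transposition. *)
Lemma mxrank_mxsub_leq (F : fieldType) m n p q (f : 'I_p -> 'I_m) (g : 'I_q -> 'I_n)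
    (A : 'M[F]_(m, n)) :
  \rank (mxsub f g A) <= \rank A.
Proof.
have le_rowsub r s t (h : 'I_r -> 'I_s) (B : 'M[F]_(s, t)) :
    \rank (rowsub h B) <= \rank B by exact/mxrankS/rowsub_sub.
rewrite mxsubrc; apply: leq_trans (le_rowsub _ _ _ f _) _.
by rewrite -mxrank_tr trmx_mxsub -[leqRHS]mxrank_tr le_rowsub.
Qed.

Lemma trig_mxsub_leq_rank (F : fieldType) m n k (f : 'I_k -> 'I_m)
    (g : 'I_k -> 'I_n) (A : 'M[F]_(m, n)) :
  (forall i, A (f i) (g i) != 0%R) ->
  (forall i j : 'I_k, i < j -> A (f i) (g j) = 0%R) ->
  k <= \rank A.
Proof.
move=> diagA trigA; apply: leq_trans (mxrank_mxsub_leq _ _ _ _ _ f g A).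
have trigB : is_trig_mx (mxsub f g A).
  by apply/is_trig_mxP => i j ltij; rewrite mxE trigA.
suff /mxrank_unit -> : mxsub f g A \in unitmx by [].
rewrite unitmxE det_trig // unitfE; apply/prodf_neq0 => i _.
by rewrite mxE diagA.
Qed.

(** Common form of the three bounds: row [x] is nonzero on [N x] and supported in [M x]. The pair
    [N], [M] will be open/closed, closed/closed and open/open neighborhoods. *)
Lemma leq_rank_sequence (F : fieldType) n (A : 'M[F]_n)
    (N M : 'I_n -> {set 'I_n}) k (v : k.-tuple 'I_n) :
  (forall x y, y \in N x -> A x y != 0%R) ->
  (forall x y, y \notin M x -> A x y = 0%R) ->
  [forall i : 'I_k,
    N (tnth v i) :\: \bigcup_(j : 'I_k | j < i) M (tnth v j) != set0] ->
  k <= \rank A.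
Proof.
move=> nzN zM /forallP priv.
have /fin_all_exists [g gP] i : exists y,
    y \in N (tnth v i) :\: \bigcup_(j : 'I_k | j < i) M (tnth v j).
  exact/set0Pn.
apply: (@trig_mxsub_leq_rank _ _ _ _ (tnth v) g) => [i | i j ltij].
  by apply: nzN; have /setDP[] := gP i.
apply: zM; have /setDP[_] := gP j.
by apply: contra => gM; apply/bigcupP; exists i.
Qed.

Lemma leq_min_rank (R : realType) n (S : 'M[R]_n -> Prop)
    (S_ex : exists A, S A) g :
  (forall A, S A -> g <= \rank A) -> g <= min_rank S_ex.
Proof.
move=> le_g; rewrite /min_rank; case: ex_minnP => r /asboolP[A SA <-] _.
exact: le_g.
Qed.

Theorem theorem3p1 (R : realType) (n : nat) (G : sgraph n) :
  [/\ gamma_gr_Z G <= mr R G,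
      gamma_gr G <= mr_l R G
    & gamma_gr_t G <= mr_0 R G].
Proof.
split; apply: leq_min_rank => A SA; apply/bigmax_leqP => k /existsP[v /andP[_]];
  apply: leq_rank_sequence => x y; rewrite ?in_setU1 !inE.
- case: SA => _ suppA adjxy; rewrite suppA //.
  by apply: contraTneq adjxy => ->; rewrite adj_irrefl.
- case: SA => _ suppA; rewrite negb_or eq_sym => /andP[neqxy].
  by rewrite -suppA // negbK => /eqP.
(* A closed neighborhood contains [x] itself, where the nonzero diagonal is used. *)
- case: SA => [[_ suppA] diagA]; have [-> // | neqxy] := eqVneq y x.
  by rewrite suppA // eq_sym.
- case: SA => [[_ suppA] _]; rewrite negb_or eq_sym => /andP[neqxy].
  by rewrite -suppA // negbK => /eqP.
- case: SA => [[_ suppA] _] adjxy; rewrite suppA //.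
  by apply: contraTneq adjxy => ->; rewrite adj_irrefl.
(* Outside the open neighborhood [y] may be [x]; the zero diagonal covers this case. *)
- case: SA => [[_ suppA] diagA]; have [<- // | neqxy] := eqVneq x y.
  by rewrite -suppA // negbK => /eqP.
Qed.
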